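(* Let $S\in\{\tfrac12,1,\tfrac32,\dots\}$, let $f_1,f_2:\mathbb N_0\to\mathbb C$ be arbitrary functions, and consider the operators $$\hat S^+=\hat a\,f_1(\hat n),\qquad \hat S^-=f_2(\hat n)\,\hat a^\dagger,\qquad \hat S^z=S-\hat n .$$ Put $G(n)=f_1(n)f_2(n)$. Then: (i) $[\hat S^z,\hat S^\pm]=\pm\hat S^\pm$ for every choice of $f_1,f_2$. (ii) The relation $[\hat S^+,\hat S^-]\,|n\rangle=2\hat S^z|n\rangle$ holds for all $n=0,1,\dots,2S$ if and only if $$(n+1)G(n+1)-nG(n)=2(S-n)\qquad\text{for } n=0,1,\dots,2S,$$ and this holds if and only if $$G(n)=2S-n+1\qquad\text{for } n=1,2,\dots,2S+1$$ (the value $G(0)$ being left unrestricted). Equivalently, for all $n=0,1,\dots,2S$, $$\hat S^-\hat S^+|n\rangle=n(2S-n+1)|n\rangle,\qquad \hat S^+\hat S^-|n\rangle=(n+1)(2S-n)|n\rangle .$$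
   Context: Let $\mathcal F$ be the complex vector space with basis $\{|n\rangle: n\in\mathbb N_0\}$ (the Fock basis of a single bosonic mode, finite linear combinations). The annihilation and creation operators are $\hat a|n\rangle=\sqrt n\,|n-1\rangle$ (so $\hat a|0\rangle=0$) and $\hat a^\dagger|n\rangle=\sqrt{n+1}\,|n+1\rangle$, and $\hat n=\hat a^\dagger\hat a$. For $F:\mathbb N_0\to\mathbb C$, the operator $F(\hat n)$ is defined by $F(\hat n)|n\rangle=F(n)|n\rangle$. The physical subspace is $\mathcal H_{\mathrm{phys}}=\mathrm{span}\{|n\rangle:0\le n\le 2S\}$. *)

(* Defs.v *)
From HB Require Import structures.
From mathcomp Require Import all_boot all_order all_algebra.
From mathcomp Require Import finmap monalg complex reals.

Set Implicit Arguments.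
Unset Strict Implicit.
Unset Printing Implicit Defensive.

Import Order.TTheory GRing.Theory Num.Theory.

Local Open Scope fset_scope.
Local Open Scope ring_scope.
Local Open Scope complex_scope.

(* Finitely supported functions nat -> R[i], of which only the lmodType
   structure is used: the complex vector space with basis indexed by nat. *)
Notation fock R := {malg R[i][nat]}.

Section Fock.
Variable R : realType.
Local Notation C := R[i].
Local Notation F := (fock R).

Definition ket (n : nat) : F := << n >>.

(* The linear map determined by its values [h n] on the basis vectors [ket n];
   see [linextE]. *)
Definition linext (h : nat -> F) (v : F) : F :=
  \sum_(n <- msupp v) v@_n *: h n.

Lemma linextEw (h : nat -> F) (d : {fset nat}) (v : F) :
  msupp v `<=` d -> linext h v = \sum_(n <- d) v@_n *: h n.
Proof.
move=> le_vd; apply: big_fset_incl => // n _ /mcoeff_outdom ->.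
by rewrite scale0r.
Qed.

Lemma linext_is_linear (h : nat -> F) : linear (linext h).
Proof.
move=> c u v; pose d := msupp u `|` msupp v `|` msupp (c *: u + v).
have /linextEw -> : msupp (c *: u + v) `<=` d by exact: fsubsetUr.
have /linextEw -> : msupp u `<=` d by rewrite /d -fsetUA fsubsetUl.
have /linextEw -> : msupp v `<=` d by rewrite /d (fsetUC (msupp u)) -fsetUA fsubsetUl.
rewrite scaler_sumr -big_split /=; apply: eq_bigr => n _.
by rewrite mcoeffD mcoeffZ scalerDl scalerA.
Qed.

HB.instance Definition _ (h : nat -> F) :=
  GRing.isLinear.Build C F F *:%R (linext h) (linext_is_linear h).

Lemma linextE (h : nat -> F) (n : nat) : linext h (ket n) = h n.
Proof.
by rewrite /linext /ket msuppU oner_eq0 big_seq_fset1 mcoeffUU scale1r.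
Qed.

Lemma ket_linear_ext (A B : {linear F -> F}) :
  (forall n, A (ket n) = B (ket n)) -> A =1 B.
Proof.
move=> eqAB v; rewrite (monalgE v) !linear_sum; apply: eq_bigr => n _.
have -> : << v@_n *g n >> = v@_n *: ket n :> F.
  by apply/malgP => k; rewrite mcoeffZ !mcoeffU mulrnAr mulr1.
by rewrite !linearZ /= eqAB.
Qed.

Definition sqrtn (n : nat) : C := (Num.sqrt (n%:R : R))%:C.

(* At n = 0 the coefficient vanishes, so the junk value 0.-1 = 0 is harmless. *)
Definition annih : F -> F := linext (fun n => sqrtn n *: ket n.-1).

Definition creat : F -> F := linext (fun n => sqrtn n.+1 *: ket n.+1).

Definition number : F -> F := creat \o annih.

Definition numfun (g : nat -> C) : F -> F := linext (fun n => g n *: ket n).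

Definition spin_plus (f1 : nat -> C) : F -> F := annih \o numfun f1.

Definition spin_minus (f2 : nat -> C) : F -> F := numfun f2 \o creat.

Definition spin_z (S : R) : F -> F := fun v => S%:C *: v - number v.

Definition commutator (A B : F -> F) : F -> F := fun v => A (B v) - B (A v).

Lemma annih_ket0 : annih (ket 0) = 0.
Proof. by rewrite /annih linextE /sqrtn sqrtr0 scale0r. Qed.

Lemma number_ket (n : nat) : number (ket n) = n%:R *: ket n.
Proof.
rewrite /number /= /annih linextE; case: n => [|n].
  by rewrite /sqrtn sqrtr0 !scale0r /creat linear0.
rewrite /creat linearZ /= linextE scalerA /sqrtn -rmorphM /=.
by rewrite -expr2 sqr_sqrtr ?ler0n // rmorph_nat.
Qed.

End Fock.

Arguments ket {R} n.

(* Main.v *)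
From HB Require Import structures.
Require Import Defs.
From mathcomp Require Import all_boot all_order all_algebra.
From mathcomp Require Import finmap monalg complex reals.
From mathcomp Require Import ring.

Import GRing.Theory Num.Theory.

Local Open Scope ring_scope.
Local Open Scope complex_scope.

(** [spin_plus] lowers the occupation number by one and [spin_minus] raises it by one, so [spin_z],
    with eigenvalue S - n, changes by +1 or -1; this is part (i). In the two products the square
    roots pair up, so both are diagonal: with G = f1 f2, S^- S^+ has eigenvalue n G(n)
    ([spin_minus_plus_ket]) and S^+ S^- has (n+1) G(n+1) ([spin_plus_minus_ket]). Comparing
    coefficients of each ket turns the commutation relation into the recurrence
    ([commutator_spin_ket]). Summing it from 0 gives n G(n) = n (2S - n + 1), and n cancels for n >=
    1 ([spin_recurrenceP]). The product formulas are these eigenvalues with the value of G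
    inserted. *)

Section SpinOperators.
Context {R : realType}.
Local Notation C := R[i].
Local Notation F := (fock R).
Implicit Types (S : R) (f g : nat -> C) (n : nat).

(** Registering the operators as linear lets scalars move through them and lets [ket_linear_ext]
    reduce operator identities to kets. *)
HB.instance Definition _ := GRing.Linear.copy (@annih R) (linext _).
HB.instance Definition _ := GRing.Linear.copy (@creat R) (linext _).
HB.instance Definition _ g := GRing.Linear.copy (@numfun R g) (linext _).
HB.instance Definition _ :=
  GRing.Linear.copy (@Defs.number R) (@creat R \o @annih R).
HB.instance Definition _ f :=
  GRing.Linear.copy (@spin_plus R f) (@annih R \o numfun f).
HB.instance Definition _ f :=
  GRing.Linear.copy (@spin_minus R f) (numfun f \o @creat R).

Lemma spin_z_is_linear S : linear (spin_z S).
Proof.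
move=> c u v; rewrite /spin_z (linearP (@Defs.number R)).
by rewrite scalerDr scalerBr !scalerA opprD [c * _]mulrC addrACA.
Qed.

HB.instance Definition _ S :=
  GRing.isLinear.Build C F F *:%R (spin_z S) (spin_z_is_linear S).

Lemma commutator_is_linear (A B : {linear F -> F}) : linear (commutator A B).
Proof.
move=> c u v; rewrite /commutator.
by rewrite (linearP A) (linearP B) (linearP A) (linearP B) scalerBr opprD
  addrACA.
Qed.

HB.instance Definition _ (A B : {linear F -> F}) :=
  GRing.isLinear.Build C F F *:%R (commutator A B) (commutator_is_linear A B).

(** Reading off the coefficient at n turns an equality of vectors into one of eigenvalues. *)
Lemma scale_ketI n : injective (fun c : C => c *: (ket n : F)).
Proof.
by move=> c d /(congr1 (mcoeff n)); rewrite !mcoeffZ mcoeffUU !mulr1.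
Qed.

Lemma sqrtn0 : sqrtn R 0 = 0.
Proof. by rewrite /sqrtn sqrtr0. Qed.

Lemma sqrtn_sqr n : sqrtn R n * sqrtn R n = n%:R.
Proof.
by rewrite /sqrtn -rmorphM /= -expr2 sqr_sqrtr ?ler0n // rmorph_nat.
Qed.

Lemma spin_z_ket S n : spin_z S (ket n) = (S%:C - n%:R) *: ket n.
Proof. by rewrite /spin_z number_ket scalerBl. Qed.

Lemma spin_plus_ket f n :
  spin_plus f (ket n) = (f n * sqrtn R n) *: ket n.-1.
Proof.
by rewrite /spin_plus /= /numfun linextE linearZ /= /annih linextE scalerA.
Qed.

Lemma spin_minus_ket f n :
  spin_minus f (ket n) = (sqrtn R n.+1 * f n.+1) *: ket n.+1.
Proof.
by rewrite /spin_minus /= /creat linextE linearZ /= /numfun linextE scalerA.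
Qed.

Lemma spin_minus_plus_ket f1 f2 n :
  spin_minus f2 (spin_plus f1 (ket n)) = (n%:R * (f1 n * f2 n)) *: ket n.
Proof.
rewrite spin_plus_ket linearZ /= spin_minus_ket scalerA.
(* At n = 0 the truncated predecessor leads to [ket 1] instead of [ket 0], but the factor
   [sqrtn R 0] kills it. *)
case: n => [|n] /=; first by rewrite sqrtn0 mulr0 !mul0r !scale0r.
by rewrite -sqrtn_sqr; congr (_ *: _); ring.
Qed.

Lemma spin_plus_minus_ket f1 f2 n :
  spin_plus f1 (spin_minus f2 (ket n)) =
  (n.+1%:R * (f1 n.+1 * f2 n.+1)) *: ket n.
Proof.
rewrite spin_minus_ket linearZ /= spin_plus_ket scalerA -sqrtn_sqr.
by congr (_ *: _); ring.
Qed.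

Lemma commutator_spin_z_plus S f :
  commutator (spin_z S) (spin_plus f) =1 spin_plus f.
Proof.
apply: ket_linear_ext => n /=; rewrite /commutator spin_z_ket linearZ /=.
rewrite spin_plus_ket linearZ /= spin_z_ket !scalerA -scalerBl.
case: n => [|n] /=; first by rewrite sqrtn0 !(mulr0, mul0r) subr0.
by congr (_ *: _); ring.
Qed.

Lemma commutator_spin_z_minus S f :
  commutator (spin_z S) (spin_minus f) =1 (fun v => - spin_minus f v).
Proof.
apply: (@ket_linear_ext R _ (-%R \o spin_minus f)) => n /=.
rewrite /commutator spin_z_ket linearZ /= spin_minus_ket linearZ /=.
rewrite spin_z_ket !scalerA -scalerBl -[RHS]scaleNr.
by congr (_ *: _); ring.
Qed.

Lemma commutator_spin_ket S f1 f2 n :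
  commutator (spin_plus f1) (spin_minus f2) (ket n) = 2 *: spin_z S (ket n) <->
  n.+1%:R * (f1 n.+1 * f2 n.+1) - n%:R * (f1 n * f2 n) = 2 * (S%:C - n%:R).
Proof.
rewrite /commutator spin_plus_minus_ket spin_minus_plus_ket spin_z_ket.
rewrite -scalerBl scalerA; split=> [/scale_ketI//|->//].
Qed.

End SpinOperators.

(* The recurrence telescopes to n * G n = n * (a - n + 1), as both sides vanish
   at n = 0; this is also why G 0 stays free. *)
Lemma spin_recurrenceP (K : numFieldType) (a : K) (G : nat -> K) (N : nat) :
  (forall n, (n <= N)%N -> n.+1%:R * G n.+1 - n%:R * G n = a - 2 * n%:R) <->
  (forall n, (1 <= n <= N.+1)%N -> G n = a - n%:R + 1).
Proof.
split=> [rec|sol] n.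
  (* The induction runs on (n+1) G(n+1), the quantity that telescopes. *)
  case: n => // n le_nN; apply: (mulfI (_ : n.+1%:R != 0)).
    by rewrite pnatr_eq0.
  elim: n le_nN => [|n IHn] le_nN.
    by move: (rec 0%N isT); rewrite mul0r mulr0 !subr0 => ->; ring.
  have /eqP := rec n.+1 le_nN; rewrite subr_eq => /eqP ->.
  by rewrite IHn ?(ltnW le_nN) //; ring.
move=> le_nN; rewrite (sol n.+1) //.
(* At n = 0 the unknown [G 0] is multiplied by 0. *)
case: n le_nN => [|n] le_nN; first by ring.
by rewrite (sol n.+1) ?ltnS ?(ltnW le_nN) //; ring.
Qed.

(* N is the natural number 2S. *)
Theorem mainTheorem1 (R : realType) (S : R) (N : nat)
    (hN : (0 < N)%N) (hS : S = N%:R / 2) (f1 f2 : nat -> R[i]) :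
  let Sp := spin_plus f1 in
  let Sm := spin_minus f2 in
  let Sz := spin_z S in
  let G := fun n : nat => f1 n * f2 n in
  let comm_rel := forall n : nat, (n <= N)%N ->
    commutator Sp Sm (ket n) = 2 *: Sz (ket n) in
  let recurrence := forall n : nat, (n <= N)%N ->
    n.+1%:R * G n.+1 - n%:R * G n = 2 * (S%:C - n%:R) in
  let solution := forall n : nat, (1 <= n <= N.+1)%N ->
    G n = 2 * S%:C - n%:R + 1 in
  let products := forall n : nat, (n <= N)%N ->
    Sm (Sp (ket n)) = (n%:R * (2 * S%:C - n%:R + 1)) *: ket n /\
    Sp (Sm (ket n)) = (n.+1%:R * (2 * S%:C - n%:R)) *: ket n in
  [/\ commutator Sz Sp =1 Sp /\ commutator Sz Sm =1 (fun v => - Sm v),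
      comm_rel <-> recurrence,
      recurrence <-> solution
    & solution <-> products].
Proof.
move=> Sp Sm Sz G comm_rel recurrence solution products; split.
- by split; [exact: commutator_spin_z_plus|exact: commutator_spin_z_minus].
- by split=> H n le_nN; apply/commutator_spin_ket; exact: H.
- apply: iff_trans (spin_recurrenceP _ (2 * S%:C) G N).
  by split=> H n /H; rewrite mulrBr.
split=> [sol n le_nN|prod [//|n] le_nN].
  rewrite /Sm /Sp spin_minus_plus_ket spin_plus_minus_ket; split.
    congr (_ *: _); case: n le_nN => [|n] le_nN; first by rewrite !mul0r.
    by congr (_ * _); apply: sol; exact: ltnW.
  congr (_ *: _); congr (_ * _); apply: etrans (sol n.+1 le_nN) _.
  by rewrite -[n.+1]addn1 natrD; ring.
(* S^+ S^- at n determines G(n+1), so n = 0, ..., N covers all of 1, ..., N+1, including the top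
   value that S^- S^+ does not reach. *)
have [_] := prod n le_nN; rewrite /Sm /Sp spin_plus_minus_ket => /scale_ketI.
have n1_neq0 : n.+1%:R != 0 :> R[i] by rewrite pnatr_eq0.
move/(mulfI n1_neq0) => Gn1; apply: etrans Gn1 _.
by rewrite -[n.+1]addn1 natrD; ring.
Qed.
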